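(* Let $\mathbb{K}\subset\mathbb{C}$ be a field. Let $A^{(k)}(x)=\sum_{|I|=k}A_Ix^I$, with $A_I\in \mathrm{Mat}(m\times n,\mathbb{K})$, be a homogeneous polynomial matrix of degree $k$, and let $A(x)=A^{(k)}(x)+(\text{terms of orders}\ge k+1)$ be a formal matrix in $Mat(m,n,p)$. Then $A$ is two-sided equivalent to a matrix $B(x)=A^{(k)}(x)+b(x)$, with $b\in Mat(m,n,p)$, satisfying both of the relations $$\left(A^{(k)}\right)^*\!\left(\tfrac{\partial}{\partial x}\right)b(x)=0,\qquad \left((A^{(k)})^T\right)^*\!\left(\tfrac{\partial}{\partial x}\right)b^T(x)=0 .$$
   Context: $m,n,p\ge 1$ are integers. $Mat(m,n,p)$ is the space of $m\times n$ matrices with entries in $\mathbb{K}[[x_1,\dots,x_p]]$ (formal matrices), written $A(x)=\sum_I A_Ix^I$ with multi-indices $I=(I_1,\dots,I_p)$, $|I|=I_1+\dots+I_p$, $x^I=x_1^{I_1}\cdots x_p^{I_p}$, $A_I\in\mathrm{Mat}(m\times n,\mathbb{K})$. Two formal matrices $A,B\in Mat(m,n,p)$ are two-sided equivalent if $B(x)=U(x)A(x)V^{-1}(x)$ for some $U\in GL(m,\mathbb{K}[[x_1,\dots,x_p]])$, $V\in GL(n,\mathbb{K}[[x_1,\dots,x_p]])$. For a polynomial matrix $P(x)=\sum_{|I|\le k}P_Ix^I$ one puts $P^*\left(\frac{\partial}{\partial x}\right)=\sum_{|I|\le k}P_I^*\frac{\partial^{|I|}}{\partial x^I}$, where $P_I^*=\overline{P_I^T}$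 is the conjugate transpose; it acts on formal matrices $b$ of suitable size by $P^*\left(\frac{\partial}{\partial x}\right)b(x)=\sum_{|I|\le k}P_I^*\frac{\partial^{|I|}b(x)}{\partial x^I}$. In particular $\left((A^{(k)})^T\right)^*\left(\frac{\partial}{\partial x}\right)=\sum_{|I|=k}\overline{A_I}\,\frac{\partial^{|I|}}{\partial x^I}$, which acts on the $n\times m$ matrix $b^T$.
   Formalization: The complex conjugates of the entries of the coefficients A_I of A^(k) are additionally assumed to lie in K; for a subfield K of C not closed under conjugation the claim can fail (e.g. x+ay+y^2 over Q(a), a a non-real cube root of 2). *)

(* Defs.v *)
From HB Require Import structures.
From mathcomp Require Import all_boot all_order all_algebra.
From mathcomp Require Export mpoly.
Set Implicit Arguments.
Unset Strict Implicit.
Unset Printing Implicit Defensive.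
Import Order.TTheory GRing.Theory Num.Theory.
Local Open Scope ring_scope.

(* An m x n matrix over F[[x_1, ..., x_p]], given by its coefficients:
   A stands for \sum_I A I x^I, with I ranging over the multi-indices. *)
Definition formal_mx (F : Type) (m n p : nat) : Type := 'X_{1..p} -> 'M[F]_(m, n).

Section FormalMatrices.
Variables (F : nzRingType) (p : nat).

Definition fmx_one (n : nat) : formal_mx F n n p :=
  fun I => if mdeg I == 0%N then 1%:M else 0.

Definition fmx_add (m n : nat) (A B : formal_mx F m n p) : formal_mx F m n p :=
  fun I => A I + B I.

(* Cauchy product; the bound on mdeg J only makes the index type finite, since
   (J <= I)%MM (componentwise order) implies mdeg J <= mdeg I. *)
Definition fmx_mul (m n q : nat) (A : formal_mx F m n p) (B : formal_mx F n q p) :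
    formal_mx F m q p :=
  fun I => \sum_(J : 'X_{1..p < (mdeg I).+1} | (J <= I)%MM) A J *m B (I - J)%MM.

Definition fmx_tr (m n : nat) (A : formal_mx F m n p) : formal_mx F n m p :=
  fun I => (A I)^T.

Definition fmx_deriv (m n : nat) (i : 'I_p) (b : formal_mx F m n p) :
    formal_mx F m n p :=
  fun I => b (I + U_(i))%MM *+ (I i).+1.

(* The derivative of order |I| with respect to x^I, as mderivm for {mpoly F[p]}. *)
Definition fmx_derivm (m n : nat) (I : 'X_{1..p}) (b : formal_mx F m n p) :
    formal_mx F m n p :=
  foldr (fun i => iter (I i) (fmx_deriv i)) b (enum 'I_p).

Definition fmx_over (K : {pred F}) (m n : nat) (A : formal_mx F m n p) : Prop :=
  forall I, A I \is a mxOver K.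

Definition fmx_homog (k m n : nat) (P : formal_mx F m n p) : Prop :=
  forall I, mdeg I != k -> P I = 0.

(* W is the inverse of U in GL(n, K[[x]]). *)
Definition fmx_GL_inv (K : {pred F}) (n : nat) (U W : formal_mx F n n p) : Prop :=
  [/\ fmx_over K U, fmx_over K W,
      fmx_mul U W =1 fmx_one n & fmx_mul W U =1 fmx_one n].

Definition two_sided_equiv (K : {pred F}) (m n : nat) (A B : formal_mx F m n p) :
    Prop :=
  exists (U Uinv : formal_mx F m m p) (V Vinv : formal_mx F n n p),
    [/\ fmx_GL_inv K U Uinv, fmx_GL_inv K V Vinv
      & B =1 fmx_mul (fmx_mul U A) Vinv].

End FormalMatrices.

Section AdjointOperator.
Variables (C : numClosedFieldType) (p : nat).

Definition conj_tr (m n : nat) (M : 'M[C]_(m, n)) : 'M[C]_(n, m) :=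
  map_mx Num.conj M^T.

(* P^*(d/dx) b, for P a polynomial matrix of degree at most k. *)
Definition adj_diffop (k m n q : nat) (P : formal_mx C m n p)
    (b : formal_mx C m q p) : formal_mx C n q p :=
  fun J => \sum_(I : 'X_{1..p < k.+1}) conj_tr (P I) *m fmx_derivm I b J.

End AdjointOperator.

(* Main.v *)
Require Import Defs.
From HB Require Import structures.
From mathcomp Require Import all_boot all_order all_algebra.
From mathcomp Require Import boolp reals complex.
Import Order.TTheory GRing.Theory Num.Theory.
Local Open Scope ring_scope.
Local Open Scope complex_scope.

Set Implicit Arguments.
Unset Strict Implicit.
Unset Printing Implicit Defensive.

(** Write [A = Ak + a] with [a] of order at least [k+1], and look for
    [U = 1 + u], [V = 1 - v] with [u], [v] of order at least 1.  Then
    [U A = (Ak + b) V] expands to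
<<
      b = c + (u Ak + Ak v),      where  c = a + u a + b v.
>>
    In degree [k+j] the term [c] involves [u] and [v] in degrees below [j] and
    [b] in degrees below [k+j], so the components of degree [j] of [u] and [v]
    are still free: they move [b] inside a coset of the image of the
    homological operator [tangent : (u, v) |-> u Ak + Ak v].

    The coset meets the kernel of the two differential operators because these
    are the adjoint of [tangent] for the Fischer pairing
<<
      <b, c> = \sum_I I! tr (b_I c_I^* ),
>>
    for which multiplication by [x_i] is adjoint to [d/dx_i]
    ([fischer_adjoint]).  The pairing is positive definite over the complex
    numbers, so [tangent] and its adjoint [adj] satisfy
    [ker (adj o tangent) = ker tangent] and [ker (tangent o adj) = ker adj].
    Both kernel identities restrict to [K], which contains the coefficients of
    [tangent] and of [adj]; comparing dimensions over [K]
    ([linear_adjoint_solve]) they give [im (adj o tangent) = im adj], hence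
    for every [c] over [K] some [(u, v)] over [K] with
    [adj (c + tangent (u, v)) = 0] ([degree_solver], [normalizer]).

    With [(u, v)] chosen as a function of [c], degree by degree, the right-hand
    side [a + u a + b v] becomes a map of [c] that gains one degree of
    precision, and a fixed point of it solves the equation
    ([fmx_contraction_fixpoint], [formal_normal_form]).  Contraction also
    inverts the unipotent [U] and [V] ([fmx_unipotent_inv]).

    The argument is carried out over the field of elements of [K], as a type of
    its own embedded in the complex numbers by a morphism [iota]. *)

(** * Sums over multi-indices of bounded degree *)
Section BoundedSums.
Variables (p : nat) (V : nmodType).
Implicit Types (I J L : 'X_{1..p}).

(** The degree bounds in the index types of such sums only ensure finiteness;
    this lets each sum be taken with the bound that suits it. *)
Lemma sum_bmnm_eq a b (P : pred 'X_{1..p}) (G : 'X_{1..p} -> V) :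
    (forall I, P I -> (mdeg I < a)%N) -> (forall I, P I -> (mdeg I < b)%N) ->
  \sum_(I : 'X_{1..p < a} | P I) G I = \sum_(I : 'X_{1..p < b} | P I) G I.
Proof.
move=> Pa Pb.
have sumE c : (forall I, P I -> (mdeg I < c)%N) ->
    forall I, (I \in [seq I <- [seq bmnm K | K <- index_enum 'X_{1..p < c}] | P I])
      = P I.
  move=> Pc I; rewrite mem_filter; case PI: (P I) => //=.
  by apply/mapP; exists (BMultinom (Pc _ PI)); rewrite ?mem_index_enum.
rewrite -(big_map (@bmnm p a) P G) -(big_map (@bmnm p b) P G).
rewrite -[LHS]big_filter -[RHS]big_filter; apply/perm_big/uniq_perm.
- by rewrite filter_uniq ?(map_inj_uniq val_inj) ?index_enum_uniq.
- by rewrite filter_uniq ?(map_inj_uniq val_inj) ?index_enum_uniq.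
- by move=> I; rewrite !sumE.
Qed.

Lemma sum_bmnm_pred1 a I (X : V) : (mdeg I < a)%N ->
  \sum_(L : 'X_{1..p < a}) (if (L : 'X_{1..p}) == I then X else 0) = X.
Proof.
by move=> Ia; rewrite -big_mkcond (big_pred1 (BMultinom Ia)).
Qed.

End BoundedSums.

(** * The Cauchy product *)
Section FormalProduct.
Variables (F : nzRingType) (p : nat).
Implicit Types (I J K L : 'X_{1..p}).

(** All locality properties of the product, with respect to the degree or to
    homogeneous components, are instances of this congruence. *)
Lemma fmx_mul_congr m n q (A A' : formal_mx F m n p) (B B' : formal_mx F n q p) I :
    (forall K J, (K + J)%MM = I -> A K *m B J = A' K *m B' J) ->
  fmx_mul A B I = fmx_mul A' B' I.
Proof.
move=> eqAB; apply: eq_bigr => K leKI; apply: eqAB.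
by rewrite addmC submK.
Qed.

(** A form of the product in which the two factors play symmetric roles, so that
    sums can be exchanged without tracking the condition [K <= I]. *)
Lemma fmx_mulE m n q (A : formal_mx F m n p) (B : formal_mx F n q p) a b I :
    (mdeg I < a)%N -> (mdeg I < b)%N ->
  fmx_mul A B I = \sum_(K : 'X_{1..p < a}) \sum_(J : 'X_{1..p < b})
    (if (K + J)%MM == I then A K *m B J else 0).
Proof.
move=> Ia Ib; rewrite /fmx_mul.
rewrite (@sum_bmnm_eq _ _ _ a (fun K => (K <= I)%MM) (fun K => A K *m B (I - K)%MM)).
- rewrite big_mkcond; apply: eq_bigr => K _; case: ifP => leKI.
    have IKb : (mdeg (I - K)%MM < b)%N by rewrite (leq_ltn_trans (mdegB _ _)).
    rewrite -[LHS](sum_bmnm_pred1 _ IKb).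
    apply: eq_bigr => J _; have -> : (J == I - K :> 'X_{1..p})%MM = ((K + J)%MM == I).
      apply/eqP/eqP => [->|<-]; first by rewrite addmC submK.
      by rewrite addmC addmK.
    by case: eqP => // <-; rewrite [(K + J)%MM]addmC addmK.
  rewrite big1 // => J _; case: eqP => // eqI.
  by rewrite -eqI lem_addr in leKI.
- by move=> K leKI; rewrite ltnS -(submK leKI) mdegD leq_addl.
by move=> K leKI; rewrite (leq_ltn_trans _ Ia) // -(submK leKI) mdegD leq_addl.
Qed.

Lemma fmx_mulA m n q r (A : formal_mx F m n p) (B : formal_mx F n q p)
    (C : formal_mx F q r p) :
  fmx_mul A (fmx_mul B C) =1 fmx_mul (fmx_mul A B) C.
Proof.
move=> I; have [N IN] : exists N, (mdeg I < N)%N by exists (mdeg I).+1.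
transitivity (\sum_(K : 'X_{1..p < N}) \sum_(J : 'X_{1..p < N})
    \sum_(M : 'X_{1..p < N})
      if (K + J + M)%MM == I then A K *m B J *m C M else 0).
- rewrite (fmx_mulE _ _ IN IN); apply: eq_bigr => K _.
  transitivity (\sum_(L : 'X_{1..p < N}) \sum_(J : 'X_{1..p < N})
     \sum_(M : 'X_{1..p < N}) if (L : 'X_{1..p}) == (J + M)%MM then
        (if (K + J + M)%MM == I then A K *m B J *m C M else 0) else 0).
    apply: eq_bigr => L _; rewrite (fmx_mulE B C (bmdeg L) (bmdeg L)).
    case: ifP => KLI.
      rewrite mulmx_sumr; apply: eq_bigr => J _.
      rewrite mulmx_sumr; apply: eq_bigr => M _.
      rewrite eq_sym; case: eqP => [eqL|_]; last by rewrite mulmx0.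
      by rewrite -addmA -eqL KLI mulmxA.
    rewrite big1 // => J _; rewrite big1 // => M _.
    by case: eqP => // eqL; rewrite -addmA -eqL KLI.
  rewrite exchange_big; apply: eq_bigr => J _.
  rewrite exchange_big; apply: eq_bigr => M _.
  case: eqP => [eqI|_]; last by rewrite big1 // => L _; rewrite if_same.
  by rewrite sum_bmnm_pred1 // (leq_ltn_trans _ IN) // -eqI -addmA (mdegD K) leq_addl.
- rewrite (fmx_mulE _ _ IN IN).
  under [LHS]eq_bigr => K _ do rewrite exchange_big.
  rewrite [LHS]exchange_big [RHS]exchange_big; apply: eq_bigr => M _.
  transitivity (\sum_(L : 'X_{1..p < N}) \sum_(K : 'X_{1..p < N})
     \sum_(J : 'X_{1..p < N}) if (L : 'X_{1..p}) == (K + J)%MM then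
        (if (K + J + M)%MM == I then A K *m B J *m C M else 0) else 0).
    rewrite [RHS]exchange_big; apply: eq_bigr => K _.
    rewrite [RHS]exchange_big; apply: eq_bigr => J _.
    case: eqP => [eqI|_]; last by rewrite big1 // => L _; rewrite if_same.
    by rewrite sum_bmnm_pred1 // (leq_ltn_trans _ IN) // -eqI (mdegD (K + J)%MM) leq_addr.
  apply: eq_bigr => L _; rewrite (fmx_mulE A B (bmdeg L) (bmdeg L)).
  case: ifP => LMI.
    rewrite mulmx_suml; apply: eq_bigr => K _.
    rewrite mulmx_suml; apply: eq_bigr => J _.
    rewrite [in RHS]eq_sym; case: eqP => [eqL|_]; last by rewrite mul0mx.
    by rewrite -eqL LMI.
  rewrite big1 // => K _; rewrite big1 // => J _.
  by case: eqP => // eqL; rewrite -eqL LMI.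
Qed.

End FormalProduct.

Section FormalRing.
Variables (F : nzRingType) (p : nat).
Implicit Types (I J K L : 'X_{1..p}).

Definition fmx_sub m n (A B : formal_mx F m n p) : formal_mx F m n p :=
  fun I => A I - B I.

Lemma fmx_mulDl m n q (A A' : formal_mx F m n p) (B : formal_mx F n q p) I :
  fmx_mul (fmx_add A A') B I = fmx_mul A B I + fmx_mul A' B I.
Proof. by rewrite -big_split; apply: eq_bigr => K _; rewrite mulmxDl. Qed.

Lemma fmx_mulDr m n q (A : formal_mx F m n p) (B B' : formal_mx F n q p) I :
  fmx_mul A (fmx_add B B') I = fmx_mul A B I + fmx_mul A B' I.
Proof. by rewrite -big_split; apply: eq_bigr => K _; rewrite mulmxDr. Qed.

Lemma fmx_mulBl m n q (A A' : formal_mx F m n p) (B : formal_mx F n q p) I :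
  fmx_mul (fmx_sub A A') B I = fmx_mul A B I - fmx_mul A' B I.
Proof. by rewrite -sumrB; apply: eq_bigr => K _; rewrite mulmxBl. Qed.

Lemma fmx_mulBr m n q (A : formal_mx F m n p) (B B' : formal_mx F n q p) I :
  fmx_mul A (fmx_sub B B') I = fmx_mul A B I - fmx_mul A B' I.
Proof. by rewrite -sumrB; apply: eq_bigr => K _; rewrite mulmxBr. Qed.

Lemma fmx_mul1l m n (A : formal_mx F m n p) : fmx_mul (@fmx_one F p m) A =1 A.
Proof.
move=> I; rewrite /fmx_mul (bigD1 (@bm0 p (mdeg I))) /=; last first.
  by apply/mnm_lepP => i; rewrite mnm0E.
rewrite /fmx_one mdeg0 eqxx mul1mx subm0 big1 ?addr0 // => K /andP[_ nzK].
by rewrite mdeg_eq0 ifN ?mul0mx.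
Qed.

Lemma fmx_mul1r m n (A : formal_mx F m n p) : fmx_mul A (@fmx_one F p n) =1 A.
Proof.
move=> I; rewrite /fmx_mul (bigD1 (BMultinom (ltnSn (mdeg I)))) ?lepm_refl //=.
rewrite /fmx_one big1 => [|K /andP[leKI neqKI]].
  by rewrite (_ : (I - I)%MM = 0%MM) ?mdeg0 ?eqxx ?mulmx1 ?addr0 //;
     apply/mnmP => i; rewrite mnmBE mnm0E subnn.
rewrite mdeg_eq0 ifN ?mulmx0 //; apply: contraNneq neqKI => eqIK.
by rewrite bmeqP /= -[X in _ == X](submK leKI) eqIK add0m.
Qed.

(** * Convergence in the degree filtration *)
Definition fmx_agree d m n (A B : formal_mx F m n p) :=
  forall I, (mdeg I < d)%N -> A I = B I.

Definition fmx_ord_ge d m n (A : formal_mx F m n p) :=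
  forall I, (mdeg I < d)%N -> A I = 0.

Lemma fmx_mul_agreel d s m n q (A A' : formal_mx F m n p) (B : formal_mx F n q p) :
  fmx_agree d A A' -> fmx_ord_ge s B -> fmx_agree (d + s) (fmx_mul A B) (fmx_mul A' B).
Proof.
move=> eqA Bs I Ids; apply: fmx_mul_congr => K J eqI.
have [Js|sJ] := ltnP (mdeg J) s; first by rewrite Bs // !mulmx0.
rewrite eqA // -(ltn_add2r s) (leq_ltn_trans _ Ids) // -eqI mdegD.
by rewrite leq_add2l.
Qed.

Lemma fmx_mul_agreer s d m n q (A : formal_mx F m n p) (B B' : formal_mx F n q p) :
  fmx_ord_ge s A -> fmx_agree d B B' -> fmx_agree (s + d) (fmx_mul A B) (fmx_mul A B').
Proof.
move=> As eqB I Ids; apply: fmx_mul_congr => K J eqI.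
have [Ks|sK] := ltnP (mdeg K) s; first by rewrite As // !mul0mx.
rewrite eqB // -(ltn_add2l s) (leq_ltn_trans _ Ids) // -eqI mdegD.
by rewrite leq_add2r.
Qed.

Lemma fmx_agree_leq d e m n (A B : formal_mx F m n p) :
  (e <= d)%N -> fmx_agree d A B -> fmx_agree e A B.
Proof. by move=> led AB I Ie; apply/AB/(leq_trans Ie). Qed.

Lemma fmx_mul_ord_ge d s m n q (A : formal_mx F m n p) (B : formal_mx F n q p) :
  fmx_ord_ge d A -> fmx_ord_ge s B -> fmx_ord_ge (d + s) (fmx_mul A B).
Proof.
move=> Ad Bs I Ids.
rewrite (@fmx_mul_agreel d s _ _ _ A (fun=> 0) B Ad Bs I Ids) /fmx_mul.
by rewrite big1 // => K _; rewrite mul0mx.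
Qed.

(** The Banach fixed point theorem for the degree ultrametric: the [d]-th iterate
    from 0 is already correct in degrees below [d], so the coefficient of [x^I]
    of the fixed point is read off the iterate of rank [mdeg I + 1]. *)
Lemma fmx_contraction_fixpoint m n
    (Phi : formal_mx F m n p -> formal_mx F m n p) :
    (forall d c c', fmx_agree d c c' -> fmx_agree d.+1 (Phi c) (Phi c')) ->
  exists c, Phi c =1 c.
Proof.
move=> contr; pose x d := iter d Phi (fun=> 0).
have xS d : fmx_agree d (x d) (x d.+1) by elim: d => // d /contr.
have x_agree d e : fmx_agree d (x d) (x (e + d)%N).
  elim: e => // e IHe I Id; rewrite IHe // addSn xS //.
  by rewrite (leq_trans Id) ?leq_addl.
exists (fun I => x (mdeg I).+1 I) => I.
set c := fun I => _; have cx d : fmx_agree d c (x d).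
  move=> J Jd; rewrite /c (@x_agree _ (d - (mdeg J).+1)%N J) ?subnK //.
by rewrite (contr (mdeg I) c (x (mdeg I))).
Qed.

(** With [N = 1 - U] of positive order, [W |-> 1 + N W] and [W |-> 1 + W N] are
    contractions; their fixed points are a right and a left inverse of [U],
    which coincide by associativity. *)
Lemma fmx_unipotent_inv n (U : formal_mx F n n p) :
    fmx_agree 1 U (@fmx_one F p n) ->
  exists W : formal_mx F n n p,
    fmx_mul U W =1 @fmx_one F p n /\ fmx_mul W U =1 @fmx_one F p n.
Proof.
move=> U1; pose N := fmx_sub (@fmx_one F p n) U.
have N1 : fmx_ord_ge 1 N by move=> I I0; rewrite /N /fmx_sub U1 ?subrr.
have [W WE] : exists W : formal_mx F n n p, fmx_mul U W =1 @fmx_one F p n.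
  have [|W WE] := @fmx_contraction_fixpoint _ _
    (fun W => fmx_add (@fmx_one F p n) (fmx_mul N W)).
    move=> d c c' eqc I Id; congr (_ + _).
    by rewrite (fmx_mul_agreer N1 eqc) ?add1n.
  exists W => I; have := WE I; rewrite /fmx_add fmx_mulBl fmx_mul1l => /eqP.
  by rewrite addrCA addrC -subr_eq0 addrK subr_eq0 eq_sym => /eqP.
have [W' W'E] : exists W : formal_mx F n n p, fmx_mul W U =1 @fmx_one F p n.
  have [|W' W'E] := @fmx_contraction_fixpoint _ _
    (fun W => fmx_add (@fmx_one F p n) (fmx_mul W N)).
    move=> d c c' eqc I Id; congr (_ + _).
    by rewrite (fmx_mul_agreel eqc N1) ?addn1.
  exists W' => I; have := W'E I; rewrite /fmx_add fmx_mulBr fmx_mul1r => /eqP.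
  by rewrite addrCA addrC -subr_eq0 addrK subr_eq0 eq_sym => /eqP.
exists W; split=> //; suff -> : W = W' by [].
apply/funext => I; rewrite -[LHS]fmx_mul1l -[RHS]fmx_mul1r.
by rewrite -[in RHS](funext WE) -(funext W'E) fmx_mulA.
Qed.

End FormalRing.

(** * Differential operators *)
Section Derivatives.
Variables (F : nzRingType) (p : nat).
Implicit Types (I J K L : 'X_{1..p}).

Lemma iter_fmx_deriv m n i c (b : formal_mx F m n p) J :
  iter c (fmx_deriv i) b J = b (J + U_(i) *+ c)%MM *+ (J i + c) ^_ c.
Proof.
elim: c J => [|c IHc] J; first by rewrite mulm0n addm0 ffactn0.
rewrite iterS /fmx_deriv IHc mulmS addmA -mulrnA; congr (b _ *+ _).
by rewrite mnmDE mnm1E eqxx addn1 addSnnS ffactnSr addnS -addSn addnK.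
Qed.

Lemma fmx_derivmE m n I (b : formal_mx F m n p) J :
  fmx_derivm I b J = b (J + I)%MM *+ \prod_i (J i + I i) ^_ (I i).
Proof.
have derivE (s : seq 'I_p) : uniq s ->
    foldr (fun i => iter (I i) (fmx_deriv i)) b s J =
    b (J + \big[+%MM/0%MM]_(i <- s) (U_(i) *+ I i))%MM
      *+ \prod_(i <- s) (J i + I i) ^_ (I i).
  elim: s J => [|i s IHs] J /=; first by rewrite !big_nil addm0.
  case/andP=> i_s s_uniq; rewrite iter_fmx_deriv IHs // !big_cons addmA.
  rewrite -mulrnA [RHS](congr1 _ (mulnC _ _)); congr (_ *+ (_ * _)).
  apply: eq_big_seq => j js; rewrite mnmDE mulmnE mnm1E.
  by case: eqP => [eij|_]; [rewrite eij js in i_s | rewrite mul0n addn0].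
rewrite /fmx_derivm derivE ?enum_uniq // !big_enum /=; congr (b (J + _)%MM *+ _).
by rewrite -multinomUE_id.
Qed.

(** [adj_diffop] without the conjugation, so that it makes sense over a field
    that need not be stable under it: [P] stands for the family of adjoint
    coefficients. *)
Definition fmx_diffop k m n q (P : formal_mx F n m p) (b : formal_mx F m q p) :
    formal_mx F n q p :=
  fun J => \sum_(I : 'X_{1..p < k.+1}) P I *m fmx_derivm I b J.

Lemma fmx_diffop_congr k m n q (P : formal_mx F n m p) (b b' : formal_mx F m q p) J :
    fmx_homog k P -> (forall I, mdeg I = (k + mdeg J)%N -> b I = b' I) ->
  fmx_diffop k P b J = fmx_diffop k P b' J.
Proof.
move=> Pk eqb; apply: eq_bigr => I _; rewrite !fmx_derivmE.
have [Ik|Ik] := eqVneq (mdeg I) k; last by rewrite Pk // !mul0mx.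
by rewrite eqb // mdegD Ik addnC.
Qed.

End Derivatives.

(** * The Fischer pairing *)
Section FischerPairing.
Variables (C : numClosedFieldType) (p : nat).
Implicit Types (I J K L : 'X_{1..p}).

Lemma conj_trK m n : cancel (@conj_tr C m n) (@conj_tr C n m).
Proof. by move=> A; apply/matrixP => i j; rewrite !mxE conjCK. Qed.

Lemma conj_trM m n q (A : 'M[C]_(m, n)) (B : 'M_(n, q)) :
  conj_tr (A *m B) = conj_tr B *m conj_tr A.
Proof. by rewrite /conj_tr trmx_mul map_mxM. Qed.

Lemma conj_trMn m n (A : 'M[C]_(m, n)) c : conj_tr (A *+ c) = conj_tr A *+ c.
Proof. by rewrite /conj_tr !raddfMn. Qed.

Lemma conj_tr_sum m n (T : finType) (A : T -> 'M[C]_(m, n)) :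
  conj_tr (\sum_t A t) = \sum_t conj_tr (A t).
Proof. by rewrite /conj_tr !raddf_sum. Qed.

Lemma mxtrace_conj_tr_ge0 m n (A : 'M[C]_(m, n)) : 0 <= \tr (A *m conj_tr A).
Proof.
apply: sumr_ge0 => i _; rewrite mxE; apply: sumr_ge0 => j _.
by rewrite !mxE mul_conjC_ge0.
Qed.

Lemma mxtrace_conj_tr_eq0 m n (A : 'M[C]_(m, n)) :
  (\tr (A *m conj_tr A) == 0) = (A == 0).
Proof.
apply/eqP/eqP => [tr0|->]; last by rewrite mul0mx mxtrace0.
have pos i j : 0 <= A i j * conj_tr A j i by rewrite !mxE mul_conjC_ge0.
apply/matrixP => i j; rewrite [RHS]mxE; apply/eqP; rewrite -mul_conjC_eq0.
move: tr0; rewrite /mxtrace; under eq_bigr do rewrite mxE.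
move=> /(psumr_eq0P (fun i _ => sumr_ge0 _ (fun j _ => pos i j))) /(_ i isT).
by move=> /(psumr_eq0P (fun j _ => pos i j)) /(_ j isT); rewrite !mxE => ->.
Qed.

Definition mnm_fact I : nat := \prod_i (I i)`!.

Lemma mnm_fact_gt0 I : (0 < mnm_fact I)%N.
Proof. by rewrite prodn_gt0 // => i; rewrite fact_gt0. Qed.

Lemma mnm_factD I J :
  mnm_fact (J + I)%MM = (\prod_i (J i + I i) ^_ (I i) * mnm_fact J)%N.
Proof.
rewrite -big_split; apply: eq_bigr => i _ /=.
by rewrite mnmDE -(ffact_fact (leq_addl (J i) (I i))) addnK.
Qed.

Definition fischer N m n (b c : formal_mx C m n p) : C :=
  \sum_(I : 'X_{1..p < N}) (mnm_fact I)%:R * \tr (b I *m conj_tr (c I)).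

Lemma fischer_eq0 N m n (c : formal_mx C m n p) :
  fischer N c c = 0 -> fmx_ord_ge N c.
Proof.
move=> c0 I IN.
have pos (K : 'X_{1..p < N}) (_ : true) :
    0 <= (mnm_fact K)%:R * \tr (c K *m conj_tr (c K)).
  by rewrite mulr_ge0 ?ler0n ?mxtrace_conj_tr_ge0.
have /eqP := psumr_eq0P pos c0 (i := BMultinom IN) isT.
by rewrite mulf_eq0 pnatr_eq0 eqn0Ngt mnm_fact_gt0 /= mxtrace_conj_tr_eq0 => /eqP.
Qed.

Lemma fischer_tr N m n (b c : formal_mx C m n p) :
  fischer N (fmx_tr b) (fmx_tr c) = fischer N b c.
Proof.
apply: eq_bigr => I _; congr (_ * _); rewrite mxtrace_mulC -mxtrace_tr trmx_mul trmxK.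
by congr (\tr (_ *m _)); apply/matrixP => i j; rewrite !mxE.
Qed.

(** The multiples of [x^K] of degree at most [k + j] are the [x^K x^J] with [J]
    of degree at most [j]. *)
Lemma sum_bmnm_shift (V : nmodType) k j K (G : 'X_{1..p} -> V) : mdeg K = k ->
  \sum_(I : 'X_{1..p < (k + j).+1} | (K <= I)%MM) G I =
  \sum_(J : 'X_{1..p < j.+1}) G (K + J)%MM.
Proof.
move=> Kk; transitivity (\sum_(J : 'X_{1..p < j.+1}) \sum_(I : 'X_{1..p < (k + j).+1})
    if (I : 'X_{1..p}) == (K + J)%MM then G I else 0); last first.
  apply: eq_bigr => J _; rewrite -[RHS](@sum_bmnm_pred1 _ _ (k + j).+1 (K + J)%MM).
    by apply: eq_bigr => I _; case: eqP => // ->.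
  by rewrite mdegD Kk ltnS leq_add2l -ltnS bmdeg.
rewrite exchange_big big_mkcond; apply: eq_bigr => I _; case: ifP => leKI.
  have IKj : (mdeg (I - K)%MM < j.+1)%N.
    have := bmdeg I; rewrite -{1}(submK leKI) mdegD Kk !ltnS addnC.
    by rewrite leq_add2l.
  rewrite -[LHS](sum_bmnm_pred1 _ IKj); apply: eq_bigr => J _.
  congr (if _ then _ else _); apply/eqP/eqP => ->; first by rewrite addmC submK.
  by rewrite addmC addmK.
by rewrite big1 // => J _; case: eqP => // eqI; rewrite eqI lem_addr in leKI.
Qed.

(** On monomials the identity is [(J+K)! = (J+K)!/J! * J!], where
    [(J+K)!/J!] is the factor produced by the derivative of order [K]; the
    powers of [x] pair up because [P] has a single degree [k], which is also why
    the truncation at degree [k + j] on the left becomes the truncation at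
    degree [j] on the right. *)
Lemma fischer_adjoint k j m n q (P : formal_mx C m n p)
    (v : formal_mx C n q p) (c : formal_mx C m q p) :
    fmx_homog k P ->
  fischer (k + j).+1 (fmx_mul P v) c = fischer j.+1 v (adj_diffop k P c).
Proof.
move=> Pk; pose G K I : C :=
  (mnm_fact I)%:R * \tr (P K *m v (I - K)%MM *m conj_tr (c I)).
transitivity (\sum_(K : 'X_{1..p < k.+1} | mdeg K == k)
    \sum_(I : 'X_{1..p < (k + j).+1} | (K <= I)%MM) G K I).
  rewrite (exchange_big_dep predT) //=; apply: eq_bigr => I _.
  rewrite -mulr_sumr -raddf_sum -mulmx_suml; congr (_ * \tr (_ *m _)).
  rewrite /fmx_mul (bigID (fun K : 'X_{1..p < _} => mdeg K == k)) /= [X in _ + X]big1.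
    rewrite addr0 (@sum_bmnm_eq _ _ _ k.+1 (fun K => (K <= I)%MM && (mdeg K == k))
      (fun K => P K *m v (I - K)%MM)).
    - by apply: eq_bigl => K; rewrite andbC.
    - by move=> K /andP[leKI _]; rewrite ltnS -(submK leKI) mdegD leq_addl.
    - by move=> K /andP[_ /eqP->].
  by move=> K /andP[_ Kk]; rewrite Pk // mul0mx.
transitivity (\sum_(K : 'X_{1..p < k.+1} | mdeg K == k)
    \sum_(J : 'X_{1..p < j.+1}) G K (K + J)%MM).
  by apply: eq_bigr => K /eqP Kk; rewrite (sum_bmnm_shift j (G K) Kk).
rewrite exchange_big; apply: eq_bigr => J _ /=.
rewrite conj_tr_sum mulmx_sumr raddf_sum mulr_sumr.
rewrite [RHS](bigID (fun K : 'X_{1..p < _} => mdeg K == k)) /=.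
rewrite [X in _ + X]big1 ?addr0 => [|K Kk]; last first.
  by rewrite Pk // conj_trM conj_trK mulmx0 mulmx0 mxtrace0 mulr0.
apply: eq_bigr => K _; rewrite /G conj_trM conj_trK fmx_derivmE conj_trMn.
rewrite [(K + J)%MM]addmC addmK mnm_factD mulmxA mxtrace_mulC -mulmxA.
rewrite [in RHS]mxtrace_mulC -[in RHS]mulmxA.
by rewrite -scaler_nat -scalemxAl mxtraceZ natrM mulrA [_%:R * _%:R in RHS]mulrC.
Qed.

End FischerPairing.

(** * Least squares without an inner product *)

(** The normal equations [g f x = g w] of a least-squares problem, where [g]
    plays the role of the adjoint of [f].  The kernel conditions, which hold for
    adjoints of a definite form, give
    [rank g <= rank (f g) <= rank f <= rank (g f)], so that [g f] and [g] have
    the same image.  No form is mentioned: it may live over a larger field. *)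
Lemma linear_adjoint_solve (F : fieldType) (V W : vectType F)
    (f : {linear V -> W}) (g : {linear W -> V}) :
    (forall v, g (f v) = 0 -> f v = 0) -> (forall w, f (g w) = 0 -> g w = 0) ->
  exists h : {linear W -> V}, forall w, g (f (h w)) = g w.
Proof.
move=> ker_gf ker_fg; pose lf := linfun f; pose lg := linfun g.
have dim_comp (V1 V2 V3 : vectType F) (a : 'Hom(V1, V2)) (b : 'Hom(V2, V3)) :
    (lker (b \o a) <= lker a)%VS -> (\dim (limg a) <= \dim (limg (b \o a)))%N.
  move=> /dimvS le_ker; rewrite -(leq_add2l (\dim (lker a))).
  have := limg_ker_dim (b \o a)%VF fullv; have := limg_ker_dim a fullv.
  by rewrite !capfv => -> <-; rewrite leq_add2r.
have dim_limg_comp (V1 V2 V3 : vectType F) (a : 'Hom(V1, V2)) (b : 'Hom(V2, V3)) :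
    (\dim (limg (b \o a)) <= \dim (limg b))%N.
  by rewrite dimvS // limg_comp limgS ?subvf.
have limgE : limg lg = limg (lg \o lf)%VF.
  apply/eqP; rewrite eq_sym eqEdim limg_comp limgS ?subvf //= -limg_comp.
  apply: (@leq_trans (\dim (limg (lf \o lg)%VF))).
    apply: dim_comp; apply/subvP => w; rewrite !memv_ker comp_lfunE !lfunE.
    by move=> /eqP/ker_fg/eqP.
  apply: leq_trans (dim_limg_comp _ _ _ _ _) _; apply: dim_comp.
  apply/subvP => v; rewrite !memv_ker comp_lfunE !lfunE.
  by move=> /eqP/ker_gf/eqP.
exists (((lg \o lf)^-1 \o lg)%VF : {linear W -> V}) => w /=.
have := @limg_lfunVK _ _ _ (lg \o lf)%VF (lg w).
rewrite -limgE memv_img ?memvf // => /(_ isT).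
by rewrite !comp_lfunE !lfunE.
Qed.

(** * Linearity and truncation *)
Section Linearity.
Variables (F : fieldType) (p : nat).

Lemma fmx_mul_linearl m n q a (A A' : formal_mx F m n p) (B : formal_mx F n q p) I :
  fmx_mul (fun I => a *: A I + A' I) B I = a *: fmx_mul A B I + fmx_mul A' B I.
Proof.
rewrite scaler_sumr -big_split; apply: eq_bigr => K _.
by rewrite mulmxDl scalemxAl.
Qed.

Lemma fmx_mul_linearr m n q a (A : formal_mx F m n p) (B B' : formal_mx F n q p) I :
  fmx_mul A (fun I => a *: B I + B' I) I = a *: fmx_mul A B I + fmx_mul A B' I.
Proof.
rewrite scaler_sumr -big_split; apply: eq_bigr => K _.
by rewrite mulmxDr scalemxAr.
Qed.

Lemma fmx_diffop_linear k m n q a (P : formal_mx F n m p) (b b' : formal_mx F m q p) J :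
  fmx_diffop k P (fun I => a *: b I + b' I) J =
  a *: fmx_diffop k P b J + fmx_diffop k P b' J.
Proof.
rewrite scaler_sumr -big_split; apply: eq_bigr => K _ /=.
by rewrite !fmx_derivmE mulrnDl scalerMnr mulmxDr scalemxAr.
Qed.

Lemma fmx_trM m n q (A : formal_mx F m n p) (B : formal_mx F n q p) :
  fmx_tr (fmx_mul A B) =1 fmx_mul (fmx_tr B) (fmx_tr A).
Proof.
move=> I; rewrite (fmx_mulE _ _ (ltnSn (mdeg I)) (ltnSn (mdeg I))) exchange_big /=.
rewrite /fmx_tr (fmx_mulE A B (ltnSn (mdeg I)) (ltnSn (mdeg I))) raddf_sum.
apply: eq_bigr => K _; rewrite raddf_sum; apply: eq_bigr => J _ /=.
by rewrite addmC; case: ifP => _; rewrite ?trmx0 ?trmx_mul.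
Qed.

Definition fmx_trunc d m n (c : formal_mx F m n p) :
    {ffun 'X_{1..p < d} -> 'M[F]_(m, n)} :=
  [ffun I => c (bmnm I)].

Definition fmx_ext d m n (x : {ffun 'X_{1..p < d} -> 'M[F]_(m, n)}) : formal_mx F m n p :=
  fun I => if insub I is Some I' then x I' else 0.

Lemma fmx_extK d m n (x : {ffun 'X_{1..p < d} -> 'M[F]_(m, n)}) (I : 'X_{1..p < d}) :
  fmx_ext x I = x I.
Proof. by rewrite /fmx_ext valK. Qed.

Lemma fmx_truncK d m n (c : formal_mx F m n p) : fmx_agree d (fmx_ext (fmx_trunc d c)) c.
Proof. by move=> I Id; rewrite -[I]/(bmnm (BMultinom Id)) fmx_extK ffunE. Qed.

Lemma fmx_ext_linear d m n a (x y : {ffun 'X_{1..p < d} -> 'M[F]_(m, n)}) :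
  fmx_ext (a *: x + y) = (fun I => a *: fmx_ext x I + fmx_ext y I).
Proof.
apply/funext => I; rewrite /fmx_ext; case: insub => [I'|]; last by rewrite scaler0 addr0.
by rewrite !ffunE.
Qed.

Lemma fmx_ext_eq0 d m n (x : {ffun 'X_{1..p < d} -> 'M[F]_(m, n)}) :
  fmx_ord_ge d (fmx_ext x) -> x = 0.
Proof. by move=> x0; apply/ffunP => I; rewrite -fmx_extK x0 ?bmdeg // ffunE. Qed.

Lemma fmx_trunc_eq0 d m n (c : formal_mx F m n p) : fmx_trunc d c = 0 -> fmx_ord_ge d c.
Proof.
move=> c0 I Id; have /ffunP/(_ (BMultinom Id)) := c0.
by rewrite !ffunE.
Qed.

End Linearity.

(** * Extension of the coefficient field *)
Section CoefficientMap.
Variables (F C : nzRingType) (iota : {rmorphism F -> C}) (p : nat).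

Definition fmx_map (q r : nat) (B : formal_mx F q r p) : formal_mx C q r p :=
  fun I => map_mx iota (B I).

Lemma fmx_map_mul q r s (B : formal_mx F q r p) (D : formal_mx F r s p) :
  fmx_map (fmx_mul B D) =1 fmx_mul (fmx_map B) (fmx_map D).
Proof.
by move=> I; rewrite /fmx_map raddf_sum; apply: eq_bigr => K _; rewrite /= map_mxM.
Qed.

Lemma fmx_map_derivm q r I (b : formal_mx F q r p) J :
  fmx_derivm I (fmx_map b) J = map_mx iota (fmx_derivm I b J).
Proof. by rewrite !fmx_derivmE raddfMn. Qed.

End CoefficientMap.

(** * The homological equation *)
Section Normalization.
Variables (F : fieldType) (C : numClosedFieldType) (iota : {rmorphism F -> C}).
Variables (m n p k : nat) (A : formal_mx F m n p) (As : formal_mx F n m p).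
Hypothesis A_homog : fmx_homog k A.
Hypothesis AsE : forall I, map_mx iota (As I) = conj_tr (map_mx iota (A I)).

(** [adjL c] and [adjR c] are the two components of the adjoint of [tangent]
    applied to [c]. *)
Definition adjL (c : formal_mx F m n p) : formal_mx F n n p := fmx_diffop k As c.
Definition adjR (c : formal_mx F m n p) : formal_mx F m m p :=
  fmx_tr (fmx_diffop k (fmx_tr As) (fmx_tr c)).
Definition tangent (u : formal_mx F m m p) (v : formal_mx F n n p) : formal_mx F m n p :=
  fmx_add (fmx_mul u A) (fmx_mul A v).

Lemma As_homog : fmx_homog k As.
Proof.
move=> I Ik; apply: (@map_mx_inj _ _ iota); rewrite AsE A_homog // !map_mx0.
by rewrite /conj_tr trmx0 map_mx0.
Qed.

Lemma fmx_map_adjL c :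
  fmx_map iota (adjL c) =1 adj_diffop k (fmx_map iota A) (fmx_map iota c).
Proof.
move=> J; rewrite /fmx_map raddf_sum; apply: eq_bigr => I _ /=.
by rewrite map_mxM AsE -fmx_map_derivm.
Qed.

Lemma fmx_map_adjR c :
  fmx_map iota (adjR c) =1
  fmx_tr (adj_diffop k (fmx_tr (fmx_map iota A)) (fmx_tr (fmx_map iota c))).
Proof.
move=> J; rewrite /fmx_map /adjR /fmx_tr -matrix.map_trmx; congr (_^T).
rewrite raddf_sum; apply: eq_bigr => I _ /=.
rewrite map_mxM -matrix.map_trmx AsE -fmx_map_derivm; congr (_ *m _).
  by apply/matrixP => i j; rewrite !mxE.
by rewrite !fmx_derivmE /fmx_map -matrix.map_trmx.
Qed.

(** The Fischer pairing takes its values in [C]: conjugation need not preserve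
    the image of [F]. *)
Definition fischerF N q r (b c : formal_mx F q r p) : C :=
  fischer N (fmx_map iota b) (fmx_map iota c).

Lemma fischerF_congr N q r (b b' c c' : formal_mx F q r p) :
  fmx_agree N b b' -> fmx_agree N c c' -> fischerF N b c = fischerF N b' c'.
Proof. by move=> bb cc; apply: eq_bigr => I _; rewrite /fmx_map bb ?cc ?bmdeg. Qed.

Lemma fischerF0r N q r (b c : formal_mx F q r p) : fmx_ord_ge N c -> fischerF N b c = 0.
Proof.
move=> c0; apply: big1 => I _; rewrite /fmx_map c0 ?bmdeg // map_mx0.
by rewrite /conj_tr trmx0 map_mx0 mulmx0 mxtrace0 mulr0.
Qed.

Lemma fischerF0l N q r (b c : formal_mx F q r p) : fmx_ord_ge N b -> fischerF N b c = 0.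
Proof.
move=> b0; apply: big1 => I _; rewrite /fmx_map b0 ?bmdeg // map_mx0.
by rewrite mul0mx mxtrace0 mulr0.
Qed.

Lemma fischerF_ge0 N q r (b : formal_mx F q r p) : 0 <= fischerF N b b.
Proof.
by apply: sumr_ge0 => I _; rewrite mulr_ge0 ?ler0n ?mxtrace_conj_tr_ge0.
Qed.

Lemma fischerF_eq0 N q r (b : formal_mx F q r p) : fischerF N b b = 0 -> fmx_ord_ge N b.
Proof.
move=> /fischer_eq0 b0 I IN; apply: (@map_mx_inj _ _ iota).
by rewrite map_mx0; apply: b0.
Qed.

Lemma fischerF_tangent j u v c :
  fischerF (k + j).+1 (tangent u v) c =
  fischerF j.+1 u (adjR c) + fischerF j.+1 v (adjL c).
Proof.
transitivity (fischer (k + j).+1 (fmx_mul (fmx_map iota u) (fmx_map iota A))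
      (fmx_map iota c)
    + fischer (k + j).+1 (fmx_mul (fmx_map iota A) (fmx_map iota v)) (fmx_map iota c)).
  rewrite -big_split; apply: eq_bigr => I _ /=.
  by rewrite -!fmx_map_mul /fmx_map map_mxD mulmxDl raddfD mulrDr.
have Ak : fmx_homog k (fmx_map iota A) by move=> I Ik; rewrite /fmx_map A_homog ?map_mx0.
congr (_ + _).
  rewrite -fischer_tr (funext (fmx_trM _ _)) fischer_adjoint => [|I Ik]; last first.
    by rewrite /fmx_tr Ak ?trmx0.
  rewrite -fischer_tr /fischerF (funext (fmx_map_adjR _)); congr (fischer _ _ _).
  by apply/funext => I; rewrite /fmx_tr trmxK.
by rewrite fischer_adjoint // /fischerF (funext (fmx_map_adjL _)).
Qed.

Section DegreeSolver.
Variable j : nat.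
Local Notation VT :=
  ({ffun 'X_{1..p < j.+1} -> 'M[F]_m} * {ffun 'X_{1..p < j.+1} -> 'M[F]_n})%type.
Local Notation WT := {ffun 'X_{1..p < (k + j).+1} -> 'M[F]_(m, n)}.

(** The truncations make the spaces finite-dimensional.  They are compatible with
    adjunction since [A] has degree [k]: [tangent] maps degree at most [j] to
    degree at most [k + j]. *)
Definition tangent_trunc (x : VT) : WT :=
  fmx_trunc _ (tangent (fmx_ext x.1) (fmx_ext x.2)).
Definition adj_trunc (c : WT) : VT :=
  (fmx_trunc _ (adjR (fmx_ext c)), fmx_trunc _ (adjL (fmx_ext c))).

Lemma tangent_trunc_linear : linear tangent_trunc.
Proof.
move=> a x y; apply/ffunP => I; rewrite !ffunE /tangent /fmx_add /= !fmx_ext_linear.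
by rewrite fmx_mul_linearl fmx_mul_linearr scalerDr addrACA.
Qed.

Lemma adj_trunc_linear : linear adj_trunc.
Proof.
move=> a x y; congr (_, _); apply/ffunP => I.
  rewrite !ffunE /adjR /fmx_tr fmx_ext_linear -linearP -fmx_diffop_linear.
  by congr (fmx_diffop _ _ _ _)^T; apply/funext => J; rewrite linearP.
by rewrite !ffunE /adjL fmx_ext_linear fmx_diffop_linear.
Qed.

HB.instance Definition _ :=
  GRing.isLinear.Build F VT WT _ tangent_trunc tangent_trunc_linear.
HB.instance Definition _ :=
  GRing.isLinear.Build F WT VT _ adj_trunc adj_trunc_linear.

Lemma adj_tangent_trunc_eq0 x : adj_trunc (tangent_trunc x) = 0 -> tangent_trunc x = 0.
Proof.
case=> /fmx_trunc_eq0 adjR0 /fmx_trunc_eq0 adjL0.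
apply/fmx_ext_eq0/fischerF_eq0.
rewrite (fischerF_congr (@fmx_truncK _ _ _ _ _ _) (fun _ _ => erefl)).
by rewrite fischerF_tangent !fischerF0r ?addr0.
Qed.

Lemma tangent_adj_trunc_eq0 c : tangent_trunc (adj_trunc c) = 0 -> adj_trunc c = 0.
Proof.
move=> /fmx_trunc_eq0 t0; have := fischerF_tangent j (fmx_ext (adj_trunc c).1)
  (fmx_ext (adj_trunc c).2) (fmx_ext c).
rewrite fischerF0l //.
rewrite -(fischerF_congr (fun _ _ => erefl) (@fmx_truncK _ _ _ _ _ (adjR _))).
rewrite -(fischerF_congr (fun _ _ => erefl) (@fmx_truncK _ _ _ _ _ (adjL _))).
move=> /esym/eqP; rewrite paddr_eq0 ?fischerF_ge0 // => /andP[/eqP x0 /eqP y0].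
rewrite [adj_trunc c]surjective_pairing; congr (_, _).
  exact/fmx_ext_eq0/fischerF_eq0.
exact/fmx_ext_eq0/fischerF_eq0.
Qed.

(** [h c] solves the homological equation up to degree [j].  It depends linearly
    on the truncation of [c]; the first two properties are what remains of this
    dependence in the sequel. *)
Lemma degree_solver :
  exists h : formal_mx F m n p -> formal_mx F m m p * formal_mx F n n p,
  [/\ forall c c', fmx_agree (k + j).+1 c c' -> h c = h c',
      forall c, fmx_ord_ge (k + j).+1 c -> h c = (fun=> 0, fun=> 0)
    & forall c J, (mdeg J <= j)%N ->
        adjR (fmx_add c (tangent (h c).1 (h c).2)) J = 0 /\
        adjL (fmx_add c (tangent (h c).1 (h c).2)) J = 0].
Proof.
have [h hE] := linear_adjoint_solve adj_tangent_trunc_eq0 tangent_adj_trunc_eq0.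
pose x c := h (- fmx_trunc (k + j).+1 c).
exists (fun c => (fmx_ext (x c).1, fmx_ext (x c).2)); split.
- move=> c c' eqc; rewrite /x (_ : fmx_trunc _ c = fmx_trunc _ c') //.
  by apply/ffunP => I; rewrite !ffunE eqc ?bmdeg.
- move=> c c0; rewrite /x (_ : fmx_trunc _ c = 0).
    rewrite oppr0 linear0 /fmx_ext /=.
    by congr (_, _); apply/funext => I; case: insub => // I'; rewrite ffunE.
  by apply/ffunP => I; rewrite !ffunE c0 ?bmdeg.
move=> c J Jj.
have adj0 : adj_trunc (fmx_trunc _
    (fmx_add c (tangent (fmx_ext (x c).1) (fmx_ext (x c).2)))) = 0.
  rewrite (_ : fmx_trunc _ _ = fmx_trunc _ c + tangent_trunc (x c)); last first.
    by apply/ffunP => I; rewrite !ffunE.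
  by rewrite linearD hE linearN subrr.
have degI I : mdeg I = (k + mdeg J)%N -> (mdeg I < (k + j).+1)%N.
  by move=> ->; rewrite ltnS leq_add2l.
case: adj0 => /fmx_trunc_eq0/(_ J Jj) <- /fmx_trunc_eq0/(_ J Jj) <-; split.
  congr (_^T); apply: fmx_diffop_congr => I Ik.
    by rewrite /fmx_tr As_homog ?trmx0.
  by rewrite /fmx_tr fmx_truncK ?degI.
by apply: fmx_diffop_congr => [|I Ik]; [apply: As_homog|rewrite fmx_truncK ?degI].
Qed.

End DegreeSolver.

(** As [A] is homogeneous, the equation in degree [J] only involves the components
    of degree [mdeg J] of [u] and [v].  So these can be taken from the solution
    [h (mdeg J) c] of that degree, which makes them depend on [c] in degrees at
    most [k + mdeg J] only. *)
Lemma normalizer : exists (Tu : formal_mx F m n p -> formal_mx F m m p)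
    (Tv : formal_mx F m n p -> formal_mx F n n p),
  [/\ forall d c c', fmx_agree (k + d) c c' ->
        fmx_agree d (Tu c) (Tu c') /\ fmx_agree d (Tv c) (Tv c'),
      forall c, fmx_ord_ge k.+1 c -> fmx_ord_ge 1 (Tu c) /\ fmx_ord_ge 1 (Tv c)
    & forall c, adjR (fmx_add c (tangent (Tu c) (Tv c))) =1 (fun=> 0) /\
                adjL (fmx_add c (tangent (Tu c) (Tv c))) =1 (fun=> 0)].
Proof.
have [h hP] := boolp.choice degree_solver.
exists (fun c J => (h (mdeg J) c).1 J), (fun c J => (h (mdeg J) c).2 J); split.
- move=> d c c' eqc; have eqh J : (mdeg J < d)%N -> h (mdeg J) c = h (mdeg J) c'.
    move=> Jd; have [loc _ _] := hP (mdeg J); apply: loc.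
    by apply: fmx_agree_leq eqc; rewrite -addnS leq_add2l.
  by split=> J Jd; rewrite eqh.
- move=> c ck; have h0 J : (mdeg J < 1)%N -> h (mdeg J) c = (fun=> 0, fun=> 0).
    rewrite ltnS leqn0 => /eqP->; have [_ h0 _] := hP 0%N.
    by apply: h0; rewrite addn0.
  by split=> J Jd; rewrite h0.
move=> c; set u := fun J => _; set v := fun J => _.
have eqt (J I : 'X_{1..p}) : mdeg I = (k + mdeg J)%N ->
    tangent u v I = tangent (h (mdeg J) c).1 (h (mdeg J) c).2 I.
  move=> Ik; congr (_ + _); apply: fmx_mul_congr => K L KL.
    have [Lk|Lk] := eqVneq (mdeg L) k; last by rewrite A_homog // !mulmx0.
    have -> // : u K = (h (mdeg J) c).1 K; rewrite /u (_ : mdeg K = mdeg J) //.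
    by apply/eqP; rewrite -(eqn_add2l k) -Ik -KL mdegD Lk addnC.
  have [Kk|Kk] := eqVneq (mdeg K) k; last by rewrite A_homog // !mul0mx.
  have -> // : v L = (h (mdeg J) c).2 L; rewrite /v (_ : mdeg L = mdeg J) //.
  by apply/eqP; rewrite -(eqn_add2l k) -Ik -KL mdegD Kk.
split=> J; have [_ _ /(_ c J (leqnn _)) [R0 L0]] := hP (mdeg J).
  rewrite -[RHS]R0; congr (_^T); apply: fmx_diffop_congr => I Ik.
    by rewrite /fmx_tr As_homog ?trmx0.
  by rewrite /fmx_tr /fmx_add (eqt J).
rewrite -[RHS]L0; apply: fmx_diffop_congr => I Ik; first exact: As_homog.
by rewrite /fmx_add (eqt J).
Qed.

(** The fixed point argument is run on [c = a + u a + b v]; the corrections [u],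
    [v] and the normal form [b] are functions of [c]. *)
Lemma formal_normal_form (a : formal_mx F m n p) : fmx_ord_ge k.+1 a ->
  exists (b : formal_mx F m n p) (U : formal_mx F m m p) (V : formal_mx F n n p),
    [/\ fmx_agree 1 U (@fmx_one F p m), fmx_agree 1 V (@fmx_one F p n),
        fmx_mul U (fmx_add A a) =1 fmx_mul (fmx_add A b) V,
        adjL b =1 (fun=> 0) & adjR b =1 (fun=> 0)].
Proof.
move=> ak; have [Tu [Tv [T_loc T_ord T_adj]]] := normalizer.
have Ak : fmx_ord_ge k A by move=> I Ik; rewrite A_homog // neq_ltn Ik.
(* Removing the degrees up to k makes u and v of positive order for every c, not
   only for the fixed point; the contraction property relies on it. *)
pose cut (c : formal_mx F m n p) : formal_mx F m n p :=
  fun I => if (mdeg I < k.+1)%N then 0 else c I.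
pose nf c := fmx_add (cut c) (tangent (Tu (cut c)) (Tv (cut c))).
pose Phi c := fmx_add (fmx_add a (fmx_mul (Tu (cut c)) a)) (fmx_mul (nf c) (Tv (cut c))).
have cut_ord c : fmx_ord_ge k.+1 (cut c) by move=> I Ik; rewrite /cut Ik.
have u_ord c : fmx_ord_ge 1 (Tu (cut c)) by have [] := T_ord _ (cut_ord c).
have v_ord c : fmx_ord_ge 1 (Tv (cut c)) by have [] := T_ord _ (cut_ord c).
have nf_ord c : fmx_ord_ge k.+1 (nf c).
  move=> I Ik; rewrite /nf /fmx_add cut_ord // /tangent /fmx_add.
  rewrite (fmx_mul_ord_ge (u_ord c) Ak) //.
  by rewrite (fmx_mul_ord_ge Ak (v_ord c)) ?addn1 // !addr0.
have Phi_ord c : fmx_ord_ge k.+1 (Phi c).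
  move=> I Ik; rewrite /Phi /fmx_add ak //.
  rewrite (fmx_mul_ord_ge (u_ord c) ak) ?add1n; last exact: ltnW.
  by rewrite (fmx_mul_ord_ge (nf_ord c) (v_ord c)) ?addn1 ?addr0 //; apply: ltnW.
have [|c cE] := @fmx_contraction_fixpoint _ _ _ _ Phi.
  move=> d c c' eqc.
  (* If d < k this says degree below k, where both sides vanish. *)
  have eqcut : fmx_agree (k + (d - k)) (cut c) (cut c').
    move=> I; rewrite /cut; case: (ltnP (mdeg I) k.+1) => // ltkI.
    rewrite -maxnE leq_max ltnNge (ltnW ltkI) /=; exact: eqc.
  have [equ eqv] := T_loc _ _ _ eqcut.
  have le_d : (d <= d - k + k)%N by rewrite addnC -maxnE leq_maxr.
  have eqnf : fmx_agree d (nf c) (nf c').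
    move=> I Id; rewrite /nf /tangent /fmx_add eqcut; last first.
      by rewrite addnC (leq_trans Id).
    rewrite (fmx_mul_agreel equ Ak) ?(leq_trans Id) //.
    by rewrite (fmx_mul_agreer Ak eqv) // addnC (leq_trans Id).
  move=> I Id; rewrite /Phi /fmx_add (fmx_mul_agreel equ ak); last first.
    by rewrite addnS (leq_trans Id).
  congr (_ + _); rewrite (fmx_mul_agreer (nf_ord c) eqv); last first.
    by rewrite addSn addnC (leq_trans Id).
  by rewrite (fmx_mul_agreel eqnf (v_ord c')) ?addn1.
have cutE : cut c = c.
  by apply/funext => I; rewrite /cut; case: ifP => // Ik; rewrite -cE Phi_ord.
set u := Tu c; set v := Tv c; set b := fmx_add c (tangent u v).
have cE' I : c I = a I + fmx_mul u a I + fmx_mul b v I.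
  by rewrite -[LHS]cE /Phi /nf cutE.
exists b, (fmx_add (@fmx_one F p m) u), (fmx_sub (@fmx_one F p n) v); split.
- by move=> I I0; rewrite /fmx_add /u -cutE u_ord ?addr0.
- by move=> I I0; rewrite /fmx_sub /v -cutE v_ord ?subr0.
- move=> I; rewrite fmx_mulDl fmx_mulBr fmx_mul1l fmx_mul1r fmx_mulDl fmx_mulDr.
  rewrite /fmx_add {1}/b /tangent /fmx_add cE'.
  set x := fmx_mul u a I; set y := fmx_mul u A I; set z := fmx_mul A v I.
  set w := fmx_mul b v I.
  rewrite [a I + x + w + _]addrACA -(addrA (a I)) [x + y]addrC [w + z]addrC.
  by rewrite -[RHS]addrA addrK -[LHS]addrA.
- by have [] := T_adj c.
- by have [] := T_adj c.
Qed.

End Normalization.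

(** * The subfield as a field, and the theorem *)
Section SubfieldType.
Variables (F : fieldType) (K : divringClosed F).

Definition subfield_type := {x : F | x \in K}.
HB.instance Definition _ := Choice.on subfield_type.
HB.instance Definition _ := SubType.on subfield_type.
HB.instance Definition _ := [SubChoice_isSubIntegralDomain of subfield_type by <:].
HB.instance Definition _ := [SubIntegralDomain_isSubField of subfield_type by <:].

Definition subfield_val : {rmorphism subfield_type -> F} := (val : subfield_type -> F).

Lemma fmx_over_lift m n p (A : formal_mx F m n p) : fmx_over K A ->
  exists B : formal_mx subfield_type m n p, A = fmx_map subfield_val B.
Proof.
move=> AK; exists (fun I => map_mx (insubd (0 : subfield_type)) (A I)).
apply/funext => I; apply/matrixP => i j; rewrite !mxE /= insubdK //.
by have /mxOverP := AK I; apply.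
Qed.

Lemma fmx_map_over m n p (B : formal_mx subfield_type m n p) :
  fmx_over K (fmx_map subfield_val B).
Proof. by move=> I; apply/mxOverP => i j; rewrite mxE; apply: valP. Qed.

Lemma fmx_map_GL_inv n p (U W : formal_mx subfield_type n n p) :
    fmx_mul U W =1 @fmx_one subfield_type p n ->
    fmx_mul W U =1 @fmx_one subfield_type p n ->
  fmx_GL_inv K (fmx_map subfield_val U) (fmx_map subfield_val W).
Proof.
move=> UW WU; split; [exact: fmx_map_over|exact: fmx_map_over| |] => I;
  rewrite -fmx_map_mul /fmx_map ?UW ?WU /fmx_one;
  by case: ifP; rewrite ?map_mx1 ?map_mx0.
Qed.

End SubfieldType.

Theorem theorem1p2 (R : realType) (K : divringClosed R[i]) (m n p k : nat)
    (hm : (1 <= m)%N) (hn : (1 <= n)%N) (hp : (1 <= p)%N)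
    (Ak A : formal_mx R[i] m n p)
    (hAkK : fmx_over K Ak)
    (hAkconj : forall I : 'X_{1..p}, conj_tr (Ak I) \is a mxOver K)
    (hAkhom : fmx_homog k Ak)
    (hAK : fmx_over K A)
    (hAlow : forall I : 'X_{1..p}, (mdeg I <= k)%N -> A I = Ak I) :
  exists b : formal_mx R[i] m n p,
    [/\ fmx_over K b,
        two_sided_equiv K A (fmx_add Ak b),
        adj_diffop k Ak b =1 (fun=> 0)
      & adj_diffop k (fmx_tr Ak) (fmx_tr b) =1 (fun=> 0)].
Proof.
have [A0 eA0] := fmx_over_lift hAK.
have [Ak0 eAk0] := fmx_over_lift hAkK.
have [As0 eAs0] := @fmx_over_lift _ K _ _ _ (fun I => conj_tr (Ak I)) hAkconj.
have map_inj : injective (@map_mx _ _ (subfield_val K) m n) by apply: map_mx_inj.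
have homog0 : fmx_homog k Ak0.
  move=> I Ik; apply: map_inj.
  by rewrite map_mx0; have := hAkhom I Ik; rewrite eAk0.
have As0E I : map_mx (subfield_val K) (As0 I) = conj_tr (map_mx (subfield_val K) (Ak0 I)).
  by have := congr1 (@^~ I) eAs0; rewrite eAk0.
have a0_ord : fmx_ord_ge k.+1 (fmx_sub A0 Ak0).
  move=> I Ik; apply/eqP; rewrite subr_eq0; apply/eqP/map_inj.
  by have := hAlow I Ik; rewrite eA0 eAk0.
have [b0 [U0 [V0 [U1 V1 UV Lb Rb]]]] := formal_normal_form homog0 As0E a0_ord.
have [Ui0 [UUi UiU]] := fmx_unipotent_inv U1.
have [Vi0 [VVi ViV]] := fmx_unipotent_inv V1.
exists (fmx_map (subfield_val K) b0); split.
- exact: fmx_map_over.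
- exists (fmx_map (subfield_val K) U0), (fmx_map (subfield_val K) Ui0),
    (fmx_map (subfield_val K) V0), (fmx_map (subfield_val K) Vi0); split.
  + exact: fmx_map_GL_inv.
  + exact: fmx_map_GL_inv.
  move=> I; rewrite eA0 -(funext (fmx_map_mul _ _ _)) -fmx_map_mul.
  have -> : A0 = fmx_add Ak0 (fmx_sub A0 Ak0).
    by apply/funext => J; rewrite /fmx_add /fmx_sub addrC subrK.
  rewrite (funext UV) /fmx_map -fmx_mulA (funext VVi) fmx_mul1r eAk0.
  by rewrite /fmx_add /fmx_map map_mxD.
- move=> I; rewrite eAk0 -(fmx_map_adjL k As0E) /fmx_map Lb.
  exact: map_mx0.
move=> I; rewrite eAk0; apply: trmx_inj.
have := fmx_map_adjR k As0E b0 I; rewrite /fmx_map Rb map_mx0 trmx0 => /esym; exact.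
Qed.
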